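(* Let $n$ be an integer with $n\geq 2$, and let $\mathcal{S}_n$ act on the space $\mathrm{Mat}_n(\mathbb{C})$ of all $n\times n$ complex matrices by the adjoint (conjugation) action $\mathrm{Ad}_g(X)=gXg^{-1}$, where $g\in\mathcal{S}_n$ is regarded as a permutation matrix. Then the Frobenius character of this representation is $$ F_{\mathrm{Mat}_n(\mathbb{C})} = \begin{cases} 2s_2 + 2s_{1,1} & \text{if } n=2;\\ 2s_3+3s_{2,1}+s_{1,1,1} & \text{if } n=3;\\ 2s_n + 3s_{n-1,1} + s_{n-2,2} + s_{n-2,1,1} & \text{if } n\geq 4. \end{cases} $$
   Context: $\mathcal{S}_n$ is the group of permutations of $[n]=\{1,\dots,n\}$, viewed as a subgroup of $\mathrm{GL}_n(\mathbb{C})$ by identifying a permutation $w$ with the permutation matrix sending the standard basis vector $e_i$ to $e_{w(i)}$. For a finite-dimensional complex representation $V$ of $\mathcal{S}_n$ with character $\chi$, the Frobenius character is the symmetric function $$F_V=\frac{1}{n!}\sum_{w\in\mathcal{S}_n}\chi(w)\,p_{\lambda(w)},$$ where $\lambda(w)$ is the cycle type of $w$, $p_k$ is the $k$-th power-sum symmetric function and $p_\lambda=\prod_i p_{\lambda_i}$. For a partition $\lambda=(\lambda_1\ge\dots\ge\lambda_l)$, $s_\lambda=\det(h_{\lambda_i+j-i})_{i,j=1}^{l}$ is the Schur function, where $h_k$ is the $k$-th complete homogeneous symmetric function ($h_0=1$ and $h_k=0$ for $k<0$); subscripts list the parts of $\lambda$, and $s_k=s_{(k)}=h_k$. If $V$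 is the irreducible representation of $\mathcal{S}_n$ indexed by $\lambda$, then $F_V=s_\lambda$, so the formula is equivalent to giving the multiplicities of the irreducible constituents. *)

(* Defs.v *)
From HB Require Import structures.
From mathcomp Require Import all_boot all_order all_algebra all_fingroup.
From mathcomp Require Import mxrepresentation.
From mathcomp Require Import complex mpoly.
From mathcomp Require Import reals.

Set Implicit Arguments.
Unset Strict Implicit.
Unset Printing Implicit Defensive.

Import GRing.Theory.
Local Open Scope ring_scope.

(* A symmetric function is determined by its restrictions to m variables for
   all m (the ring of symmetric functions is the graded inverse limit of the
   rings of symmetric polynomials in m variables).  Each function below is given
   as the family, indexed by the number m of variables, of these restrictions;
   two symmetric functions are equal iff they agree for every m. *)
Section SymmetricFunctions.

Variables (C : comNzRingType) (m : nat).

Definition psum (k : nat) : {mpoly C[m]} := \sum_(i < m) 'X_i ^+ k.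

Definition psum_part (la : seq nat) : {mpoly C[m]} := \prod_(k <- la) psum k.

(* The sum of all monomials of degree k; the bound k.+1 on the degree only makes
   the index type finite. *)
Definition hsym (k : nat) : {mpoly C[m]} :=
  \sum_(t : 'X_{1..m < k.+1} | mdeg t == k) 'X_[t].

Definition hsymz (z : int) : {mpoly C[m]} :=
  match z with Posz k => hsym k | Negz _ => 0 end.

(* Jacobi-Trudi determinant; since both indices start at 0 here, the shift j - i
   is unchanged. *)
Definition schur (la : seq nat) : {mpoly C[m]} :=
  \det (\matrix_(i < size la, j < size la)
          hsymz ((nth 0%N la i)%:Z + j%:Z - i%:Z)).

End SymmetricFunctions.

Definition cycle_type (n : nat) (w : 'S_n) : seq nat :=
  sort geq [seq #|c| | c : {set 'I_n} in porbits w].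

Definition frobenius (C : fieldType) (n d : nat)
    (rho : mx_representation C [set: 'S_n]%G d) (m : nat) : {mpoly C[m]} :=
  (n`!%:R^-1 : C) *:
    \sum_(w : 'S_n) \tr (rho w) *: psum_part C m (cycle_type w).

Section Adjoint.

Variables (C : fieldType) (n : nat).

(* The matrix sending the column vector e_i to e_(w i); it is the transpose of
   the library's perm_mx w, which acts on row vectors. *)
Definition permutation_matrix (w : 'S_n) : 'M[C]_n :=
  \matrix_(i, j) (i == w j)%:R.

Definition Ad (w : 'S_n) (X : 'M[C]_n) : 'M[C]_n :=
  permutation_matrix w *m X *m invmx (permutation_matrix w).

Lemma Ad_is_linear w : linear (Ad w).
Proof. by move=> a X Y; rewrite /Ad mulmxDr mulmxDl -scalemxAr -scalemxAl. Qed.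

HB.instance Definition _ w :=
  GRing.isLinear.Build C 'M[C]_n 'M[C]_n _ (Ad w) (Ad_is_linear w).

Lemma permutation_matrixE w : permutation_matrix w = (perm_mx w)^T.
Proof. by apply/matrixP => i j; rewrite !mxE eq_sym. Qed.

(* The library composes permutations from left to right,
   (u * v) i = v (u i), hence the reversal. *)
Lemma permutation_matrixM u v :
  permutation_matrix (u * v)%g = permutation_matrix v *m permutation_matrix u.
Proof. by rewrite !permutation_matrixE perm_mxM trmx_mul. Qed.

Lemma permutation_matrix_unit w : permutation_matrix w \in unitmx.
Proof. by rewrite permutation_matrixE unitmx_tr unitmx_perm. Qed.

Lemma Ad_repr : mx_repr [set: 'S_n] (fun w => lin_mx (Ad w)).
Proof.
have Ad1 X : Ad 1%g X = X.
  by rewrite /Ad permutation_matrixE perm_mx1 trmx1 invmx1 mul1mx mulmx1.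
split=> [|u v _ _]; apply/row_matrixP => i; rewrite !rowE.
  rewrite mulmx1; set x := delta_mx _ _.
  rewrite -[x]vec_mxK mul_vec_lin; congr mxvec; exact: Ad1.
set x := delta_mx _ _; rewrite mulmxA -[x]vec_mxK !mul_vec_lin /=; congr mxvec.
have uU := permutation_matrix_unit u; have uV := permutation_matrix_unit v.
rewrite /Ad permutation_matrixM.
suff -> : invmx (permutation_matrix v *m permutation_matrix u)
        = invmx (permutation_matrix u) *m invmx (permutation_matrix v).
  by rewrite !mulmxA.
have uW : permutation_matrix v *m permutation_matrix u \in unitmx.
  by rewrite unitmx_mul uV.
apply: (can_inj (mulKmx uW)); rewrite mulmxV // mulmxA.
by rewrite mulmxK // mulmxV.
Qed.

(* Matrix representations act on row vectors from the right, which together with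
   the left-to-right composition of permutations gives the usual left action;
   Mat_n(C) is identified with row vectors of length n * n through mxvec. *)
Definition Ad_representation : mx_representation C [set: 'S_n]%G (n * n) :=
  MxRepresentation Ad_repr.

End Adjoint.

(* Main.v *)
(* The trace of Ad_w is fix(w)^2, where fix(w) is the number of fixed points.
   Expanding p_(lambda(w)) as the sum of the monomials of the colourings of [n]
   that are constant on the cycles of w, orbit counting gives
   sum_w p_(lambda(w)) = n! h_n.  Removing a fixed point splits off a factor p_1,
   so pairing w with one and then two of its fixed points yields
   F = h_1 h_(n-1) + h_1^2 h_(n-2), and the Jacobi-Trudi determinants of the
   right-hand side add up to the same polynomial. *)

Require Import Defs.
From mathcomp Require Import all_boot all_order all_algebra all_fingroup.
From mathcomp Require Import mxrepresentation.
From mathcomp Require Import complex mpoly reals ring.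

Set Implicit Arguments.
Unset Strict Implicit.
Unset Printing Implicit Defensive.

Import GRing.Theory Num.Theory.
Local Open Scope ring_scope.

(** * Colourings of [[n]] and their contents *)

Definition invariant_colouring n m (w : 'S_n) (f : {ffun 'I_n -> 'I_m}) :=
  [forall k, f (w k) == f k].

Definition content n m (f : {ffun 'I_n -> 'I_m}) : 'X_{1..m} :=
  (\sum_k U_(f k))%MM.

Definition extend_colouring n m (i : 'I_n.+1) (a : 'I_m)
    (g : {ffun 'I_n -> 'I_m}) : {ffun 'I_n.+1 -> 'I_m} :=
  [ffun k => oapp g a (unlift i k)].

Definition nfix n (w : 'S_n) : nat := (\sum_i (w i == i))%N.

Section Colourings.

Variable m : nat.

Lemma invariant_colouring_porbit n (w : 'S_n) (f : {ffun 'I_n -> 'I_m}) k l :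
  invariant_colouring w f -> porbit w k = porbit w l -> f k = f l.
Proof.
move=> /forallP fw /eqP; rewrite eq_porbit_mem => /porbitP[d ->].
by elim: d => [|d IH]; rewrite ?expg0 ?perm1 // expgSr permM (eqP (fw _)).
Qed.

Lemma extend_colouring_id n i a (g : {ffun 'I_n -> 'I_m}) :
  extend_colouring i a g i = a.
Proof. by rewrite ffunE unlift_none. Qed.

Lemma extend_colouring_lift n i a (g : {ffun 'I_n -> 'I_m}) k :
  extend_colouring i a g (lift i k) = g k.
Proof. by rewrite ffunE liftK. Qed.

Lemma extend_colouringK n i (f : {ffun 'I_n.+1 -> 'I_m}) :
  extend_colouring i (f i) [ffun k => f (lift i k)] = f.
Proof.
apply/ffunP=> k; case: (unliftP i k) => [k'|] ->.
  by rewrite extend_colouring_lift ffunE.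
by rewrite extend_colouring_id.
Qed.

Lemma invariant_extend_colouring n i a (g : {ffun 'I_n -> 'I_m}) (s : 'S_n) :
  invariant_colouring (lift_perm i i s) (extend_colouring i a g)
    = invariant_colouring s g.
Proof.
apply/forallP/forallP=> [H k|H k].
  by have := H (lift i k); rewrite lift_perm_lift !extend_colouring_lift.
case: (unliftP i k) => [k'|] ->; last by rewrite lift_perm_id.
by rewrite lift_perm_lift !extend_colouring_lift.
Qed.

Lemma mdeg_content n (f : {ffun 'I_n -> 'I_m}) : mdeg (content f) = n.
Proof.
rewrite /content mdeg_sum (eq_bigr (fun=> 1%N)) => [|k _]; last exact: mdeg1.
by rewrite sum1_card card_ord.
Qed.

(** Induction on [n]: a variable [a] occurring in [t] becomes the colour of the first place, and
    [t - U_(a)] is realised on the others. *)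
Lemma content_surj n (t : 'X_{1..m}) :
  mdeg t = n -> exists f : {ffun 'I_n -> 'I_m}, content f = t.
Proof.
elim: n t => [|n IH] t tn.
  have /eqP -> : t == 0%MM by rewrite -mdeg_eq0 tn.
  have c (k : 'I_0) : 'I_m by case: k.
  by exists [ffun k => c k]; rewrite /content big_ord0.
have [a ta] : exists a, (0 < t a)%N.
  apply/existsP; apply: contraPT (tn) => /existsPn t0.
  by rewrite mdegE big1 // => a _; have := t0 a; case: (t a).
have Ut : (U_(a) <= t)%MM.
  by apply/mnm_lepP=> b; rewrite mnm1E; case: eqP => // <-.
have [g gt] : exists g : {ffun 'I_n -> 'I_m}, content g = (t - U_(a))%MM.
  by apply: IH; have := congr1 mdeg (submK Ut); rewrite mdegD mdeg1 addn1 tn => -[].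
exists (extend_colouring ord0 a g).
rewrite /content big_ord_recl extend_colouring_id.
rewrite (eq_bigr (fun k => U_(g k)%MM)) => [|k _].
  by rewrite -/(content g) gt addmC submK.
by rewrite extend_colouring_lift.
Qed.

Lemma content_count n (f : {ffun 'I_n -> 'I_m}) c :
  content f c = count_mem c [tuple f k | k < n].
Proof.
rewrite /content mnm_sumE -sum1_count big_map big_enum_cond /= [RHS]big_mkcond.
by apply: eq_bigr => k _; rewrite mnm1E; case: eqP.
Qed.

(** A content records how often each colour occurs, so equal contents make the two lists of colours
    rearrangements of each other. *)
Lemma eq_content n (f g : {ffun 'I_n -> 'I_m}) :
  content f = content g -> exists u : 'S_n, forall k, f k = g (u k).
Proof.
move=> fg.
have /tuple_permP[u fu] : perm_eq [tuple f k | k < n] [tuple g k | k < n].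
  apply/allP=> c _; apply/eqP.
  by apply: etrans (content_count g c); rewrite -fg content_count.
exists u => k; have := congr1 (fun s => nth (f k) s k) fu.
by rewrite -!tnth_nth !tnth_mktuple.
Qed.

Lemma content_perm n (f g : {ffun 'I_n -> 'I_m}) (u : 'S_n) :
  (forall k, f k = g (u k)) -> content f = content g.
Proof.
move=> fg; rewrite /content [RHS](reindex_inj (@perm_inj _ u)).
by apply: eq_bigr => k _; rewrite fg.
Qed.

(* Orbit counting: permuting the places acts transitively on the colourings of
   a given content, so the orders of their stabilizers add up to n!. *)
Lemma sum_card_stabilizers n (t : 'X_{1..m}) : mdeg t = n ->
  (\sum_(f : {ffun 'I_n -> 'I_m} | content f == t)
     #|[pred w : 'S_n | invariant_colouring w f]|)%N = n`!.
Proof.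
move=> /content_surj[g gt]; rewrite -card_Sn -sum1_card.
(* Split the group according to the colouring [g \o w], for one fixed [g] of content [t]. *)
rewrite [RHS](partition_big (fun w : 'S_n => [ffun k => g (w k)])
   (fun f => content f == t)) /= => [|w _]; last first.
  by rewrite -gt; apply/eqP/(@content_perm _ _ _ w) => k; rewrite ffunE.
apply: eq_bigr => f /eqP; rewrite -gt => /eq_content[u fu].
(* Since [f = g \o u], translation by [u] carries the stabilizer of [f] onto the fibre over [f]. *)
rewrite -sum1_card [RHS](reindex_inj (mulIg u)) /=; apply: eq_bigl => w.
rewrite inE; apply/forallP/eqP => [fw|/ffunP fw k].
  by apply/ffunP=> k; rewrite ffunE permM -fu (eqP (fw k)).
by rewrite -(fw k) ffunE permM -fu.
Qed.

(** * Power sums as sums over invariant colourings *)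

Variable C : comNzRingType.

Lemma psum_part_cycle_typeE n (w : 'S_n) :
  psum_part C m (cycle_type w)
    = \prod_(c in porbits w) psum C m #|c|.
Proof.
rewrite /psum_part (perm_big [seq #|c| | c : {set 'I_n} in porbits w]).
  by rewrite big_image.
by rewrite /cycle_type perm_sort.
Qed.

(** Expanding the product of power sums picks one colour per cycle, which amounts to an invariant
    colouring. *)
Lemma psum_part_colourings n (w : 'S_n) :
  psum_part C m (cycle_type w)
    = \sum_(f : {ffun 'I_n -> 'I_m} | invariant_colouring w f)
        \prod_k 'X_(f k).
Proof.
(* Cycles form a finite type [I], so that choices of colours are functions on [I]; [rep] selects a
   point of each cycle and gives the inverse bijection. *)
pose I := {c : {set 'I_n} | c \in porbits w}.
have memw k : porbit w k \in porbits w by apply: imset_f.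
pose cyc k : I := exist _ (porbit w k) (memw k).
have ex_repr (c : I) : exists k, cyc k == c.
  case/imsetP: (valP c) => k _ ck; exists k; apply/eqP/val_inj.
  by rewrite /= -ck.
pose rep c := xchoose (ex_repr c).
have repK c : cyc (rep c) = c by apply/eqP/(xchooseP (ex_repr c)).
rewrite psum_part_cycle_typeE big_sub.
rewrite bigA_distr_bigA.
rewrite [RHS](reindex (fun g : {ffun I -> 'I_m} => [ffun k => g (cyc k)])) /=.
  apply: eq_big => [g|g _].
    apply/esym/forallP=> k; rewrite !ffunE; apply/eqP; congr (g _).
    by apply/val_inj; rewrite /= -[w k]/((w ^+ 1)%g k) porbit_perm.
  rewrite [RHS](partition_big cyc predT) //; apply: eq_bigr => c _.
  rewrite (eq_bigr (fun=> 'X_(g c))) => [|k /andP[_ /eqP <-]]; last by rewrite ffunE.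
  rewrite prodr_const; congr (_ ^+ _); apply: eq_card => k.
  rewrite -(repK c); apply: etrans (_ : (cyc k == cyc (rep c)) = _); last by [].
  by rewrite -(inj_eq val_inj) eq_porbit_mem.
exists (fun f => [ffun c => f (rep c)]) => [g _|f fw].
  by apply/ffunP=> c; rewrite !ffunE repK.
apply/ffunP=> k; rewrite !ffunE.
by apply: (invariant_colouring_porbit fw); case: (repK (cyc k)).
Qed.

(** The colour of the fixed point [i] is free and contributes [p_1]; the other places carry a
    colouring invariant under [s]. *)
Lemma psum_part_lift_perm n i (s : 'S_n) :
  psum_part C m (cycle_type (lift_perm i i s))
    = psum C m 1 * psum_part C m (cycle_type s).
Proof.
rewrite !psum_part_colourings /psum big_distrl /=.
under [RHS]eq_bigr do rewrite big_distrr /=.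
rewrite pair_big /=.
rewrite (reindex (fun ag : 'I_m * {ffun 'I_n -> 'I_m} =>
   extend_colouring i ag.1 ag.2)) /=.
  apply: eq_big => [[a g]|[a g] _] /=; first exact: invariant_extend_colouring.
  rewrite (bigD1_ord i) //= extend_colouring_id expr1; congr (_ * _).
  by apply: eq_bigr => k _; rewrite extend_colouring_lift.
exists (fun f => (f i, [ffun k => f (lift i k)])) => [[a g] _|f _] /=.
  rewrite extend_colouring_id; congr (_, _); apply/ffunP=> k.
  by rewrite ffunE extend_colouring_lift.
exact: extend_colouringK.
Qed.

Lemma sum_psum_part n :
  \sum_(w : 'S_n) psum_part C m (cycle_type w) = hsym C m n *+ n`!.
Proof.
under eq_bigr do rewrite psum_part_colourings.
(* Each colouring is now weighted by the order of its stabilizer; grouping by content gives every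
   monomial of degree [n] the weight [n!]. *)
rewrite (exchange_big_dep predT) //=.
have bound f : (mdeg (@content n m f) < n.+1)%N by rewrite mdeg_content.
rewrite (partition_big (fun f => BMultinom (bound f))
          (fun t : 'X_{1..m < n.+1} => mdeg t == n)) /=; last first.
  by move=> f _; rewrite mdeg_content.
rewrite /hsym -sumrMnl; apply: eq_bigr => t /eqP tn.
rewrite -(sum_card_stabilizers tn) -sumrMnr.
apply: eq_big => [f|f /eqP <-]; first by rewrite -val_eqE.
rewrite sumr_const /=; congr (_ *+ _).
by rewrite /content (big_morph _ (@mpolyXD m C) (mpolyX0 m C)).
Qed.

(** * Removing fixed points *)

Lemma sum_perm_fix n (i : 'I_n.+1) (V : nmodType) (F : 'S_n.+1 -> V) :
  \sum_(w : 'S_n.+1 | w i == i) F w = \sum_(s : 'S_n) F (lift_perm i i s).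
Proof.
rewrite (reindex (lift_perm i i)) /=; last first.
  (* Delete [i] from the source and [w i] from the target. The default [k] is never reached, because
     [w (lift i k)] differs from [w i]. *)
  pose res (w : 'S_n.+1) k := odflt k (unlift (w i) (w (lift i k))).
  have resK (w : 'S_n.+1) k : lift (w i) (res w k) = w (lift i k).
    rewrite /res; have := neq_lift i k.
    by rewrite -(inj_eq (@perm_inj _ w)) => /unlift_some[? ? ->].
  have res_inj w : injective (res w).
    move=> k l kl; apply/(@lift_inj _ i)/(@perm_inj _ w).
    by rewrite -!resK kl.
  exists (fun w => perm (@res_inj w)) => [s _|w /eqP wi].
    by apply/permP=> k; rewrite permE /res lift_perm_lift lift_perm_id liftK.
  apply/permP=> k; case: (unliftP i k) => [k'|] ->; last first.
    by rewrite lift_perm_id.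
  by rewrite lift_perm_lift permE -[X in lift X _]wi resK.
by apply: eq_bigl => s; rewrite lift_perm_id eqxx.
Qed.

Lemma nfix_lift_perm n i (s : 'S_n) : nfix (lift_perm i i s) = (nfix s).+1.
Proof.
rewrite /nfix (bigD1_ord i) //= lift_perm_id eqxx add1n; congr _.+1.
by apply: eq_bigr => k _; rewrite lift_perm_lift (inj_eq (@lift_inj _ i)).
Qed.

(** Double counting of pairs of a permutation and one of its fixed points. The weight [phi] is
    arbitrary so that the step can be iterated. *)
Lemma sum_psum_part_nfix n (phi : nat -> nat) :
  \sum_(w : 'S_n.+1) psum_part C m (cycle_type w) *+ (nfix w * phi (nfix w))
    = psum C m 1 * (\sum_(s : 'S_n)
        psum_part C m (cycle_type s) *+ phi (nfix s).+1) *+ n.+1.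
Proof.
pose F (w : 'S_n.+1) := psum_part C m (cycle_type w) *+ phi (nfix w).
transitivity (\sum_(i < n.+1) \sum_(w : 'S_n.+1 | w i == i) F w).
  rewrite (exchange_big_dep predT) //=; apply: eq_bigr => w _.
  by rewrite sumr_const mulnC mulrnA /nfix -sum1_card [in RHS]big_mkcond.
rewrite (eq_bigr (fun=> psum C m 1 * \sum_(s : 'S_n)
   psum_part C m (cycle_type s) *+ phi (nfix s).+1)) => [|i _].
  by rewrite sumr_const card_ord.
rewrite sum_perm_fix big_distrr /=; apply: eq_bigr => s _.
by rewrite /F psum_part_lift_perm nfix_lift_perm mulrnAr.
Qed.

Lemma hsym0 : hsym C m 0 = 1.
Proof.
rewrite -[LHS]mulr1n -(sum_psum_part 0) (big_pred1 1%g) => [|w].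
  rewrite psum_part_cycle_typeE big_pred0 // => c.
  by apply/imsetP => -[[]].
by apply/esym/eqP/permP => -[].
Qed.

Lemma hsym1 : hsym C m 1 = psum C m 1.
Proof.
rewrite -[LHS]mulr1n -(sum_psum_part 1).
rewrite (eq_bigl (fun w : 'S_1 => w ord0 == ord0)) => [|w]; last by rewrite ord1.
rewrite sum_perm_fix; under eq_bigr do rewrite psum_part_lift_perm.
by rewrite -big_distrr /= sum_psum_part hsym0 mulr1.
Qed.

Lemma sum_psum_part_nfix_sqr n :
  \sum_(w : 'S_n.+2) psum_part C m (cycle_type w) *+ (nfix w ^ 2)
    = (hsym C m 1 * hsym C m n.+1 + hsym C m 1 ^+ 2 * hsym C m n) *+ n.+2`!.
Proof.
under eq_bigr do rewrite -mulnn.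
rewrite (sum_psum_part_nfix n.+1 id).
(* The remaining weight is [nfix s + 1]: the summand 1 yields [h_(n+1)], and [nfix s] calls for a
   second removal. *)
under eq_bigr do rewrite mulrS.
rewrite big_split /= sum_psum_part.
under [X in _ + X]eq_bigr do rewrite -[nfix _]muln1.
rewrite (sum_psum_part_nfix n (fun=> 1%N)).
under eq_bigr do rewrite mulr1n.
rewrite sum_psum_part -hsym1 mulrnAr -mulrnA mulnC -factS.
rewrite -mulrnDl mulrnAr -mulrnA mulnC -factS mulrDr mulrA.
by rewrite expr2.
Qed.

End Colourings.

(** * The character of the adjoint representation *)

Section Trace.

Variable C : fieldType.

(** Conjugation permutes the matrix units, sending [E_(i,j)] to [E_(w i, w j)]; this is the diagonal
    coefficient that enters the trace. *)
Lemma Ad_delta n (w : 'S_n) i j :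
  Ad w (delta_mx i j : 'M[C]_n) i j = ((w i == i) * (w j == j))%:R.
Proof.
have uP : perm_mx w^-1 \in @unitmx C n by apply: unitmx_perm.
have invP : invmx (perm_mx w^-1) = perm_mx w :> 'M[C]_n.
  by apply: (can_inj (mulKmx uP)); rewrite mulmxV // -perm_mxM mulVg perm_mx1.
rewrite /Ad permutation_matrixE tr_perm_mx invP -row_permE.
rewrite -{2}[w]invgK -col_permE !mxE mulnb.
by rewrite !(can2_eq (permKV w) (permK w)) ![w _ == _]eq_sym.
Qed.

Lemma trace_Ad n (w : 'S_n) :
  \tr (Ad_representation C n w) = (nfix w ^ 2)%:R.
Proof.
rewrite /= /mxtrace (reindex _ (curry_mxvec_bij _ _)) /=.
rewrite -mulnn /nfix big_distrlr /= pair_big natr_sum /=.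
apply: eq_bigr => [[i j]] _ /=.
rewrite -Ad_delta.
have := mul_vec_lin (Ad w) (delta_mx i j : 'M[C]_n).
move/rowP/(_ (mxvec_index i j)); rewrite mxvecE mxvec_delta -rowE => <-.
by rewrite [RHS]mxE.
Qed.

End Trace.

(** * Jacobi-Trudi determinants of small size *)

Section Schur.

Variables (C : comNzRingType) (m : nat).
Local Notation h := (hsym C m).
Local Notation s := (schur C m).

Lemma det_matrix2 (A : comNzRingType) (F : nat -> nat -> A) :
  \det (\matrix_(i < 2, j < 2) F i j) = F 0 0 * F 1 1 - F 0 1 * F 1 0.
Proof.
rewrite (expand_det_row _ ord0) !big_ord_recl big_ord0 /cofactor.
rewrite !det_mx11 !mxE /= /bump /=; ring.
Qed.

Lemma det_matrix3 (A : comNzRingType) (F : nat -> nat -> A) :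
  \det (\matrix_(i < 3, j < 3) F i j) =
    F 0 0 * (F 1 1 * F 2 2 - F 1 2 * F 2 1)
    - F 0 1 * (F 1 0 * F 2 2 - F 1 2 * F 2 0)
    + F 0 2 * (F 1 0 * F 2 1 - F 1 1 * F 2 0).
Proof.
rewrite (expand_det_row _ ord0) !big_ord_recl big_ord0 /cofactor.
rewrite !(expand_det_row _ ord0) !big_ord_recl !big_ord0 /cofactor.
rewrite !det_mx11 !mxE /= /bump /=; ring.
Qed.

Definition jacobi_trudi (la : seq nat) (i j : nat) : {mpoly C[m]} :=
  hsymz C m ((nth 0%N la i)%:Z + j%:Z - i%:Z).

Lemma jacobi_trudiE la i j : (i <= nth 0 la i + j)%N ->
  jacobi_trudi la i j = h (nth 0 la i + j - i).
Proof. by move=> le_i; rewrite /jacobi_trudi -PoszD subzn. Qed.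

Lemma schur1 a : s [:: a] = h a.
Proof.
rewrite /schur det_mx11 mxE -[LHS]/(jacobi_trudi [:: a] 0 0).
by rewrite jacobi_trudiE //= addn0 subn0.
Qed.

(** Writing the second part as [b.+1] keeps the lower-left subscript [b] nonnegative. *)
Lemma schur2 a b : s [:: a; b.+1] = h a * h b.+1 - h a.+1 * h b.
Proof.
rewrite /schur (det_matrix2 (jacobi_trudi [:: a; b.+1])).
by rewrite !jacobi_trudiE //= ?addn0 ?addn1 ?subn0 ?subn1.
Qed.

Lemma schur_hook3 a :
  s [:: a; 1; 1]%N = h a * (h 1 ^+ 2 - h 2) - h a.+1 * h 1 + h a.+2.
Proof.
rewrite /schur (det_matrix3 (jacobi_trudi [:: a; 1; 1]%N)).
(* The subscript here is 1 + 0 - 2 = -1. *)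
have -> : jacobi_trudi [:: a; 1; 1]%N 2 0 = 0 by [].
rewrite !jacobi_trudiE //= !addn0 !addn1 !addn2 !subn0 /=.
by rewrite hsym0; ring.
Qed.

End Schur.

Lemma frobenius_Ad (C : numFieldType) n m :
  frobenius (Ad_representation C n.+2) m
    = hsym C m 1 * hsym C m n.+1 + hsym C m 1 ^+ 2 * hsym C m n.
Proof.
rewrite /frobenius; under eq_bigr do rewrite trace_Ad scaler_nat.
rewrite sum_psum_part_nfix_sqr -scaler_nat scalerA mulVf ?scale1r //.
by rewrite pnatr_eq0 -lt0n fact_gt0.
Qed.

Theorem theorem1p2 (R : realType) (n : nat) (hn : (2 <= n)%N) (m : nat) :
  let s (la : seq nat) := schur (complex R) m la in
  frobenius (Ad_representation (complex R) n) m =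
    if n == 2%N then
      2%:R *: s [:: 2]%N + 2%:R *: s [:: 1; 1]%N
    else if n == 3%N then
      2%:R *: s [:: 3]%N + 3%:R *: s [:: 2; 1]%N + s [:: 1; 1; 1]%N
    else
      2%:R *: s [:: n]%N + 3%:R *: s [:: n - 1; 1]%N + s [:: n - 2; 2]%N
        + s [:: n - 2; 1; 1]%N.
Proof.
case: n hn => [|[|n]] // _ s; rewrite {}/s frobenius_Ad.
case: n => [|[|n]] /=; rewrite ?subn1 ?subn2 /= !scaler_nat.
- rewrite schur1 schur2 hsym0; ring.
- rewrite schur1 schur2 schur_hook3 hsym0; ring.
(* For [n >= 4] the terms [h_(n-2) h_2] of [s_(n-2,2)] and [s_(n-2,1,1)] cancel. *)
- rewrite schur1 !schur2 schur_hook3 hsym0; ring.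
Qed.
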